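(* Let $R$ be an associative unital ring, let $u,v\in S_n$ and $i\in[1,n-2]$. The following hold when evaluated at any $x\in\mathrm{Mat}_n(R)$ for which all the positive quasiminors and inverses involved are defined. If $\ell(us_is_{i+1}s_i)=\ell(u)+3$, then $$\Delta^{i+1}_{us_{i+1},v}=\Delta^{i+1}_{us_is_{i+1},v}+\Delta^i_{us_{i+1}s_i,v}(\Delta^i_{us_i,v})^{-1}\Delta^{i+1}_{u,v}.$$ If $\ell(vs_is_{i+1}s_i)=\ell(v)+3$, then $$\Delta^{i+1}_{u,vs_{i+1}}=\Delta^{i+1}_{u,vs_is_{i+1}}+\Delta^{i+1}_{u,v}(\Delta^i_{u,vs_i})^{-1}\Delta^i_{u,vs_{i+1}s_i}.$$
   Context: $[a,b]=\{a,\dots,b\}$; $s_i=(i,i+1)\in S_n$ is the simple transposition and $\ell(w)$ is the number of inversions of $w\in S_n$. Quasideterminants: for a square matrix $A=(a_{ij})_{i\in I,j\in J}$ over $R$, $|A|_{ij}=a_{ij}$ if $|I|=1$; otherwise, if $A^{ij}$ ($A$ with row $i$ and column $j$ deleted) is invertible, $|A|_{ij}=a_{ij}-r_i(A^{ij})^{-1}c_j$, where $r_i$ is row $i$ of $A$ without $a_{ij}$ and $c_j$ is column $j$ of $A$ without $a_{ij}$. Positive quasiminors: for $I,J\subset[1,n]$ with $|I|=|J|$, $i\in I$, $j\in J$, $\Delta^{i,j}_{I,J}(x)=(-1)^{d_i(I)+d_j(J)}|x_{I,J}|_{i,j}$, where $x_{I,J}$ is the submatrix with rows $I$ and columns $J$,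 and $d_i(I)$ (resp. $d_j(J)$) is the number of elements of $I$ greater than $i$ (resp. of $J$ greater than $j$). For $u,v\in S_n$ and $k\in[1,n]$, $\Delta^k_{u,v}:=\Delta^{u(k),v(k)}_{u[1,k],v[1,k]}$. *)

(* Defs.v *)
From HB Require Import structures.
From mathcomp Require Import all_boot all_order all_algebra all_fingroup.
From mathcomp Require Import boolp classical_sets.

Set Implicit Arguments.
Unset Strict Implicit.
Unset Printing Implicit Defensive.

Import GRing.Theory.
Local Open Scope ring_scope.

(* [R] is an arbitrary associative unital ring, so neither [\is a GRing.unit]
   nor [invmx] is available: inverses are two-sided and chosen classically,
   with value 0 when there is none. *)

Definition is_inverse (R : pzRingType) (a b : R) : Prop :=
  a * b = 1 /\ b * a = 1.

Definition invertible (R : pzRingType) (a : R) : Prop :=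
  exists b, is_inverse a b.

Definition inverse (R : pzRingType) (a : R) : R :=
  xget 0 [set b | is_inverse a b]%classic.

Definition is_mxinverse (R : pzRingType) (m n : nat)
    (A : 'M[R]_(m, n)) (B : 'M[R]_(n, m)) : Prop :=
  A *m B = 1%:M /\ B *m A = 1%:M.

Definition mxinvertible (R : pzRingType) (m n : nat) (A : 'M[R]_(m, n)) : Prop :=
  exists B, is_mxinverse A B.

Definition mxinverse (R : pzRingType) (m n : nat) (A : 'M[R]_(m, n)) :
    'M[R]_(n, m) :=
  xget 0 [set B | is_mxinverse A B]%classic.

(* The submatrix of [x] with rows [I] and columns [J]; its type is rectangular
   because [#|I|] and [#|J|] need not be convertible when they are equal. *)
Definition submx_set (R : pzRingType) (m n : nat) (x : 'M[R]_(m, n))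
    (I : {set 'I_m}) (J : {set 'I_n}) : 'M[R]_(#|I|, #|J|) :=
  \matrix_(p < #|I|, q < #|J|) x (enum_val p) (enum_val q).

(* [quasidet x I J i j] is the quasideterminant |A|_ij of the matrix
   A = (x a b)_(a in I, b in J); it is meaningful only under
   [quasidet_defined x I J i j]. *)
Definition quasidet_defined (R : pzRingType) (m n : nat) (x : 'M[R]_(m, n))
    (I : {set 'I_m}) (J : {set 'I_n}) (i : 'I_m) (j : 'I_n) : Prop :=
  [/\ #|I| = #|J|, i \in I, j \in J &
      #|I| = 1%N \/ mxinvertible (submx_set x (I :\ i) (J :\ j))].

Definition quasidet (R : pzRingType) (m n : nat) (x : 'M[R]_(m, n))
    (I : {set 'I_m}) (J : {set 'I_n}) (i : 'I_m) (j : 'I_n) : R :=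
  if #|I| == 1%N then x i j
  else
    let r := \row_(q < #|J :\ j|) x i (enum_val q) in
    let c := \col_(p < #|I :\ i|) x (enum_val p) j in
    x i j - (r *m mxinverse (submx_set x (I :\ i) (J :\ j)) *m c) 0 0.

Definition num_greater (n : nat) (i : 'I_n) (I : {set 'I_n}) : nat :=
  #|[set a in I | (i < a)%N]|.

Definition quasiminor (R : pzRingType) (n : nat) (x : 'M[R]_n)
    (I J : {set 'I_n}) (i j : 'I_n) : R :=
  (-1) ^+ (num_greater i I + num_greater j J) * quasidet x I J i j.

(* [1, n] is represented by ['I_n], the ordinal [k] standing for k + 1. *)

Definition initial_image (n : nat) (u : 'S_n) (k : 'I_n) : {set 'I_n} :=
  [set u a | a : 'I_n & (a <= k)%N].

Definition Delta (R : pzRingType) (n : nat) (k : 'I_n) (u v : 'S_n)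
    (x : 'M[R]_n) : R :=
  quasiminor x (initial_image u k) (initial_image v k) (u k) (v k).

Definition Delta_defined (R : pzRingType) (n : nat) (k : 'I_n) (u v : 'S_n)
    (x : 'M[R]_n) : Prop :=
  quasidet_defined x (initial_image u k) (initial_image v k) (u k) (v k).

(* Products in S_n are composed right to left, (u \oS w) a = u (w a), whereas
   the group law of MathComp composes permutations left to right. *)
Definition perm_comp (n : nat) (u w : 'S_n) : 'S_n := (w * u)%g.
Notation "u \oS w" := (perm_comp u w) (at level 40, left associativity).

(* [ordS] is cyclic, so this is a simple transposition only when i.+1 < n. *)
Definition simple_transp (n : nat) (i : 'I_n) : 'S_n := tperm i (ordS i).

Definition perm_length (n : nat) (w : 'S_n) : nat :=
  #|[set p : 'I_n * 'I_n | (p.1 < p.2)%N && (w p.2 < w p.1)%N]|.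

(* Main.v *)
Require Import Defs.
From HB Require Import structures.
From mathcomp Require Import all_boot all_order all_algebra all_fingroup.
From mathcomp Require Import boolp classical_sets zify.

Set Implicit Arguments.
Unset Strict Implicit.
Unset Printing Implicit Defensive.

Import GRing.Theory.
Local Open Scope ring_scope.


(** A quasideterminant |x_{I,J}|_{ij} is a ratio read off kernel vectors: if z is
    supported on J and x z vanishes on the rows I \ i, then (x z)_i =
    |x_{I,J}|_{ij} z_j.  The length condition says u(i) < u(i+1) < u(i+2) =:
    a < b < c, which makes all signs cancel.  Subtract the vectors normalised to
    1 at v(i+1) that kill the rows P + a and P + b, where P = u[1, i-1]: the
    difference z is supported on v[1, i] and kills P, so its values at rows b
    and c are |.|_{b,v(i)} z_{v(i)} and |.|_{c,v(i)} z_{v(i)}; eliminating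
    z_{v(i)} gives the first identity.  The second one is the first one for the
    transpose of x over the converse ring R^c. *)

(** * Two-sided inverses and their uniqueness *)

Lemma invertibleP (R : pzRingType) (a : R) :
  invertible a -> is_inverse a (inverse a).
Proof.
by case=> b hb; apply: (xgetPex 0 (P := [set b | is_inverse a b])); exists b.
Qed.

Lemma mxinvertibleP (R : pzRingType) (m n : nat) (A : 'M[R]_(m, n)) :
  mxinvertible A -> is_mxinverse A (mxinverse A).
Proof.
by case=> B hB; apply: (xgetPex 0 (P := [set B | is_mxinverse A B])); exists B.
Qed.

Lemma inverse_unique (R : pzRingType) (a b c : R) :
  is_inverse a b -> is_inverse a c -> b = c.
Proof. by move=> [_ ba] [ac _]; rewrite -[b]mulr1 -ac mulrA ba mul1r. Qed.

Lemma mxinverse_unique (R : pzRingType) (m n : nat) (A : 'M[R]_(m, n)) B C :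
  is_mxinverse A B -> is_mxinverse A C -> B = C.
Proof. by move=> [_ ba] [ac _]; rewrite -[B]mulmx1 -ac mulmxA ba mul1mx. Qed.

(** * Quasideterminants through kernel vectors *)

Section Quasideterminants.

Variables (R : pzRingType) (m n : nat) (x : 'M[R]_(m, n)).
Implicit Types (I : {set 'I_m}) (J : {set 'I_n}).

(** Merges the two cases of the definition: when [I] is a singleton the deleted matrix is empty, [0]
    inverts it, and the correction term is an empty sum. *)
Lemma quasidet_definedE I J i j : quasidet_defined x I J i j ->
  [/\ i \in I, j \in J, mxinvertible (submx_set x (I :\ i) (J :\ j)) &
   quasidet x I J i j = x i j - ((\row_(q < #|J :\ j|) x i (enum_val q)) *m
     mxinverse (submx_set x (I :\ i) (J :\ j)) *m
     (\col_(p < #|I :\ i|) x (enum_val p) j)) 0 0].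
Proof.
case=> cIJ iI jJ; rewrite /quasidet; case: eqP => [cI _|nI []//].
have cI0 : #|I :\ i| = 0%N by move: (cardsD1 i I); rewrite iI cI => -[].
have cJ0 : #|J :\ j| = 0%N by move: (cardsD1 j J); rewrite jJ -cIJ cI => -[].
have no_ord k (a : 'I_k) : k = 0%N -> False by move=> k0; case: a; rewrite k0.
split=> //; last by rewrite mxE big1 ?subr0 // => a; case: (no_ord _ a).
exists 0; split; apply/matrixP => a; first by case: (no_ord _ a).
by case: (no_ord _ a).
Qed.

(** With [A] the deleted matrix and [c] the deleted column, the rows [I :\ i] give [A z' = - c z_j],
    so [z' = - A^-1 c z_j]; substitute this in row [i]. Scalars stay on the right throughout. *)
Lemma quasidet_kernel I J i j (z : 'I_n -> R) : quasidet_defined x I J i j ->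
  (forall p, p \in I :\ i -> \sum_(q in J) x p q * z q = 0) ->
  \sum_(q in J) x i q * z q = quasidet x I J i j * z j.
Proof.
move=> /quasidet_definedE[iI jJ /mxinvertibleP[_ BA] ->] hz.
set A := submx_set _ _ _ in BA *; set B := mxinverse A in BA *.
set r := \row__ _; set c := \col__ _.
pose zc : 'cV[R]_#|J :\ j| := \col_q z (enum_val q).
have Az : A *m zc = - (c *m (z j)%:M).
  apply/colP => p; rewrite !mxE big_ord1 !mxE eqxx mulr1n.
  have := hz _ (enum_valP p); rewrite (big_setD1 j jJ) /= => /eqP.
  rewrite addr_eq0 => /eqP->; rewrite opprK [RHS]big_enum_val.
  by apply: eq_bigr => q _; rewrite !mxE.
have Ez : zc = - (B *m c *m (z j)%:M).
  by rewrite -[LHS]mul1mx -BA -mulmxA Az mulmxN mulmxA.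
rewrite (big_setD1 j jJ) /= [X in _ + X]big_enum_val mulrBl; congr (_ + _).
transitivity ((r *m zc) 0 0).
  by rewrite mxE; apply: eq_bigr => q _; rewrite !mxE.
by rewrite Ez mulmxN !mulmxA mxE mxE big_ord1 [_%:M _ _]mxE eqxx mulr1n.
Qed.

(** Take 1 at [j] and [- A^-1 c] on [J :\ j]. *)
Lemma quasidet_kernel_exists I J i j : quasidet_defined x I J i j ->
  exists2 z : 'I_n -> R, z j = 1 &
    forall p, p \in I :\ i -> \sum_(q in J) x p q * z q = 0.
Proof.
move=> /quasidet_definedE[iI jJ /mxinvertibleP[AB _] _].
set A := submx_set _ _ _ in AB; set B := mxinverse A in AB.
pose w := B *m (\col_(p < #|I :\ i|) x (enum_val p) j).
have Aw : A *m w = \col_(p < #|I :\ i|) x (enum_val p) j.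
  by rewrite mulmxA AB mul1mx.
(* The sum has at most one term, as [enum_val] is injective; it moves the coordinates of [w] to
   [J :\ j] and gives 0 outside [J]. *)
pose z q := if q == j then 1 else
  - \sum_(a : 'I_#|J :\ j| | enum_val a == q) w a 0.
exists z => [|p pI]; first by rewrite /z eqxx.
rewrite (big_setD1 j jJ) /= {1}/z eqxx mulr1 [X in _ + X]big_enum_val /=.
have -> : x p j = \sum_(a < #|J :\ j|) x p (enum_val a) * w a 0.
  move/colP/(_ (enum_rank_in pI p)): Aw; rewrite !mxE enum_rankK_in // => <-.
  by apply: eq_bigr => a _; rewrite !mxE enum_rankK_in.
rewrite -big_split big1 //= => a _; rewrite /z.
have := enum_valP a; rewrite !inE => /andP[/negPf-> _].
rewrite (big_pred1 a) ?mulrN ?subrr // => b.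
by apply/eqP/eqP => [/enum_val_inj|->].
Qed.

(** The elimination before any division: both equations share the factor [z], which is solved for
    once the quasideterminant at [b], [d] is inverted. *)
Lemma quasidet_exchange (P : {set 'I_m}) (Q : {set 'I_n}) a b c d e :
  c \notin [set a; b] :|: P -> e \notin d |: Q ->
  quasidet_defined x (c |: (a |: P)) (e |: (d |: Q)) c e ->
  quasidet_defined x (c |: (b |: P)) (e |: (d |: Q)) c e ->
  quasidet_defined x (c |: P) (d |: Q) c d ->
  quasidet_defined x (b |: P) (d |: Q) b d ->
  quasidet_defined x (b |: (a |: P)) (e |: (d |: Q)) b e ->
  exists z,
    quasidet x (c |: (a |: P)) (e |: (d |: Q)) c e =
      quasidet x (c |: (b |: P)) (e |: (d |: Q)) c e
      + quasidet x (c |: P) (d |: Q) c d * z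
    /\ quasidet x (b |: (a |: P)) (e |: (d |: Q)) b e =
      quasidet x (b |: P) (d |: Q) b d * z.
Proof.
move=> + eQ hac hbc hcd hbd hba.
rewrite !inE !negb_or => /andP[/andP[ca cb] cP].
have [f fe f0] := quasidet_kernel_exists hac.
have [g ge g0] := quasidet_kernel_exists hbc.
have f0' p : p \in a |: P -> \sum_(q in e |: (d |: Q)) x p q * f q = 0.
  move=> pP; apply: f0; rewrite in_setD1 in_setU1 pP orbT andbT.
  by apply: contraTneq pP => ->; rewrite !inE negb_or ca.
have g0' p : p \in b |: P -> \sum_(q in e |: (d |: Q)) x p q * g q = 0.
  move=> pP; apply: g0; rewrite in_setD1 in_setU1 pP orbT andbT.
  by apply: contraTneq pP => ->; rewrite !inE negb_or cb.
have := quasidet_kernel hac f0; rewrite fe mulr1 => Ef.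
have := quasidet_kernel hbc g0; rewrite ge mulr1 => Eg.
(* Since [f] kills [a |: P], its value at row [b] is a quasideterminant too, just like its value at
   row [c]. *)
have : forall p, p \in (b |: (a |: P)) :\ b ->
    \sum_(q in e |: (d |: Q)) x p q * f q = 0.
  by move=> p; rewrite in_setD1 in_setU1 => /andP[/negPf->]; apply: f0'.
move/(quasidet_kernel hba); rewrite fe mulr1 => Eb.
(* Both vectors are 1 at [e], so the terms at [e] cancel in the difference. *)
have Eh p : \sum_(q in d |: Q) x p q * (f q - g q) =
    \sum_(q in e |: (d |: Q)) x p q * f q - \sum_(q in e |: (d |: Q)) x p q * g q.
  rewrite !(big_setU1 _ eQ) /= fe ge mulr1 opprD addrACA subrr add0r -sumrB.
  by apply: eq_bigr => q _; rewrite mulrBr.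
have h0 p : p \in P -> \sum_(q in d |: Q) x p q * (f q - g q) = 0.
  by move=> pP; rewrite Eh f0' ?g0' ?subrr ?in_setU1 ?pP ?orbT.
have h0' r p : p \in (r |: P) :\ r ->
    \sum_(q in d |: Q) x p q * (f q - g q) = 0.
  by rewrite in_setD1 in_setU1 => /andP[/negPf->]; apply: h0.
exists (f d - g d).
have := quasidet_kernel hcd (h0' c); have := quasidet_kernel hbd (h0' b).
rewrite !Eh Ef Eg Eb g0' ?setU11 // subr0 => -> <-.
by rewrite addrC subrK.
Qed.

End Quasideterminants.

(** * Lengths of permutations and initial images *)

Section Permutations.

Variable n : nat.
Implicit Types (w : 'S_n) (k : 'I_n).

Lemma perm_compE (u w : 'S_n) a : (u \oS w) a = u (w a).
Proof. exact: permM. Qed.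

Lemma ordSE k : (k.+1 < n)%N -> ordS k = k.+1 :> nat.
Proof. exact: modn_small. Qed.

(** Exchanging [k] and [k + 1] preserves the order of every other pair of positions, so it injects
    the remaining inversions of the product into those of [w]; the pair itself contributes the last
    term. *)
Lemma perm_length_ascent w k : (k.+1 < n)%N ->
  (perm_length (w \oS simple_transp k) <= perm_length w + (w k < w (ordS k)))%N.
Proof.
move=> /ordSE; rewrite /simple_transp; move: (ordS k) => k' k1.
rewrite /perm_length (cardsD1 (k, k')) addnC inE /= !perm_compE.
rewrite tpermL tpermR k1 ltnSn leq_add2r.
pose s (p : 'I_n * 'I_n) := (tperm k k' p.1, tperm k k' p.2).
have s_inj : injective s by case=> a b [c d] [] /perm_inj-> /perm_inj->.
rewrite -(card_imset _ s_inj).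
apply/subset_leq_card/fintype.subsetP => q /imsetP[[a b] + ->{q}].
rewrite !inE /= xpair_eqE !perm_compE => /and3P[nab ab ->].
rewrite andbT; move: nab ab; rewrite -!val_eqE /= k1.
case: tpermP => [?|?|+ +]; case: tpermP => [?|?|+ +]; subst=> //;
  rewrite -?val_eqE /= ?k1; lia.
Qed.

(** Each of the three factors adds at most 1 to the length, so a total of 3 makes all of them
    ascents; these compare the values of [w] at [i] and [i + 1], at [i] and [i + 2], and at [i + 1]
    and [i + 2]. *)
Lemma perm_length_braid w (i : 'I_n) : (i.+2 < n)%N ->
  let s := simple_transp i in
  let s1 := simple_transp (ordS i) in
  perm_length (w \oS s \oS s1 \oS s) = (perm_length w + 3)%N ->
  (w i < w (ordS i) < w (ordS (ordS i)))%N.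
Proof.
move=> hi s s1 hl.
have i1 : ordS i = i.+1 :> nat by rewrite ordSE // ltnW.
have i2 : ordS (ordS i) = i.+2 :> nat by rewrite ordSE i1.
have := perm_length_ascent w (ltnW hi).
have := perm_length_ascent (w \oS s \oS s1) (ltnW hi).
have := @perm_length_ascent (w \oS s) (ordS i); rewrite i1 => /(_ hi).
rewrite hl !perm_compE /s /s1 /simple_transp.
move: (ordS (ordS i)) i2 => k2 i2; move: (ordS i) i1 => k1 i1.
rewrite !tpermL !tpermR (tpermD (z := i)) ?tpermL -?val_eqE /= ?i1 ?i2; try lia.
by rewrite (tpermD (z := k2)) -?val_eqE /= ?i1 ?i2; lia.
Qed.

Definition strict_initial_image w k : {set 'I_n} :=
  [set w a | a : 'I_n & (a < k)%N].

Lemma initial_imageE w k :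
  initial_image w k = w k |: strict_initial_image w k.
Proof.
rewrite /initial_image /strict_initial_image -imsetU1.
congr (_ @: mem (_ : {set _})).
by apply/finset.setP => a; rewrite !inE leq_eqVlt.
Qed.

Lemma initial_image_ordS w k : (k.+1 < n)%N ->
  initial_image w (ordS k) = w (ordS k) |: initial_image w k.
Proof.
move=> hk; rewrite initial_imageE /strict_initial_image; 
congr (_ |: _ @: mem (_ : {set _})).
by apply/finset.setP => a; rewrite !inE ordSE.
Qed.

Lemma mem_strict_initial_image w k a :
  (w a \in strict_initial_image w k) = (a < k)%N.
Proof. by rewrite mem_imset ?inE //; apply: perm_inj. Qed.

Lemma strict_initial_image_comp w k (j : 'I_n) : (k <= j)%N -> (j.+1 < n)%N ->
  strict_initial_image (w \oS simple_transp j) k = strict_initial_image w k.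
Proof.
move=> kj hj; apply: eq_in_imset => a; rewrite inE => ak.
rewrite perm_compE /simple_transp tpermD // -val_eqE /= ?modn_small //; lia.
Qed.

(** With [a < b < c], this reduces every row sign to a count in [P] alone. *)
Lemma num_greater_setU1 (j a : 'I_n) (I : {set 'I_n}) : (a <= j)%N ->
  num_greater j (a |: I) = num_greater j I.
Proof.
move=> aj; rewrite /num_greater; apply: eq_card => b; rewrite !inE.
by case: eqP => [->|//]; rewrite ltnNge aj /= andbF.
Qed.

End Permutations.

(** * The row identity and its signs *)

Lemma Delta_row_exchange (R : pzRingType) (n : nat) (u v : 'S_n) (i : 'I_n)
    (hi : (i.+2 < n)%N) (x : 'M[R]_n) :
  let i1 := ordS i in
  let s := simple_transp i in
  let s1 := simple_transp i1 in
  perm_length (u \oS s \oS s1 \oS s) = (perm_length u + 3)%N ->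
  Delta_defined i1 (u \oS s1) v x ->
  Delta_defined i1 (u \oS s \oS s1) v x ->
  Delta_defined i (u \oS s1 \oS s) v x ->
  Delta_defined i (u \oS s) v x ->
  Delta_defined i1 u v x ->
  invertible (Delta i (u \oS s) v x) ->
  Delta i1 (u \oS s1) v x =
    Delta i1 (u \oS s \oS s1) v x +
    Delta i (u \oS s1 \oS s) v x * inverse (Delta i (u \oS s) v x) *
      Delta i1 u v x.
Proof.
move=> i1 s s1 /(perm_length_braid hi) /andP[]; rewrite -/i1.
have i1E : i1 = i.+1 :> nat by rewrite ordSE // ltnW.
have i2E : ordS i1 = i.+2 :> nat by rewrite ordSE // i1E.
have s1i : s1 i = i.
  by rewrite /s1 /simple_transp tpermD //; apply/eqP => /(congr1 (@nat_of_ord n));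
    rewrite ?i2E ?i1E; lia.
have si2 : s (ordS i1) = ordS i1.
  by rewrite /s /simple_transp tpermD //; apply/eqP => /(congr1 (@nat_of_ord n));
    rewrite ?i2E ?i1E; lia.
have si : s i = i1 by rewrite /s /simple_transp tpermL.
have si1 : s i1 = i by rewrite /s /simple_transp tpermR.
have s1i1 : s1 i1 = ordS i1 by rewrite /s1 /simple_transp tpermL.
rewrite /Delta_defined /Delta /quasiminor.
rewrite !initial_image_ordS ?(ltnW hi) // !initial_imageE.
(* [s] and [s1] fix all positions below [i], so all the row sets contain the same [P]. *)
rewrite !strict_initial_image_comp ?i1E ?(ltnW hi) //.
rewrite !perm_compE ?(s1i, si, s1i1, si1, si2).
rewrite -/i1.
have cP : u (ordS i1) \notin strict_initial_image u i.
  by rewrite mem_strict_initial_image i2E; lia.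
have eQ : v i1 \notin v i |: strict_initial_image v i.
  rewrite in_setU1 mem_strict_initial_image (inj_eq perm_inj).
  by apply/norP; split; [apply/eqP => /(congr1 (@nat_of_ord n))|];
    rewrite i1E; lia.
move: (u i) (u i1) (u (ordS i1)) (v i) (v i1) cP eQ => a b c d e.
move: (strict_initial_image u i) (strict_initial_image v i) => P Q cP eQ ab bc.
(* Nothing orders [d] and [e], so the column sign at [e] is frozen as one number [k], common to the
   three larger minors. *)
have ac := ltn_trans ab bc; set k := num_greater e _.
rewrite !num_greater_setU1 ?(ltnW ab) ?(ltnW bc) ?(ltnW ac) //.
move=> hac hbc hcd hbd hba.
have [|z [-> ->]] := quasidet_exchange _ eQ hac hbc hcd hbd hba.
  rewrite !inE !negb_or cP andbT -!(inj_eq val_inj) /=; lia.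
move: (num_greater b P) (num_greater c P) (num_greater d Q) k => h g l k.
move/invertibleP; set inv := inverse _; case=> _.
move: (quasidet _ _ _ b d) inv => y inv hinv.
(* This exhibits the inverted minor, sign included, as a left factor, so that [inv] cancels it
   whole. *)
have -> : (-1) ^+ (h + k) * (y * z) = (-1) ^+ (h + l) * y * ((-1) ^+ (l + k) * z).
  rewrite -!(signr_odd _ (_ + _)) !oddD; do 3 case: (odd _);
  by rewrite /= ?(expr0, expr1, mulN1r, mul1r, mulrN, mulNr, opprK).
rewrite -[_ * inv * _]mulrA [inv * _]mulrA hinv mul1r mulrDr; congr (_ + _).
(* Only parities matter, and [l] occurs twice. *)
rewrite -!(signr_odd _ (_ + _)) !oddD; do 3 case: (odd _);
by rewrite /= ?(expr0, expr1, mulN1r, mul1r, mulrN, mulNr, opprK).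
Qed.

(** * Transposition over the converse ring *)

Lemma is_inverse_converse (R : pzRingType) (a b : R) :
  is_inverse a b -> is_inverse (R := R^c) a b.
Proof. by case=> ab ba; split. Qed.

(** Inverses are chosen separately in the two rings; uniqueness makes the choices agree. *)
Lemma invertible_converse (R : pzRingType) (a : R) :
  invertible a ->
  invertible (R := R^c) a /\ inverse (R := R^c) a = inverse a.
Proof.
move=> /invertibleP/is_inverse_converse ai.
have ha : invertible (R := R^c) a by exists (inverse a).
by split=> //; apply: inverse_unique ai; apply: invertibleP.
Qed.

Lemma is_mxinverse_converse (R : pzRingType) (m n : nat)
    (A : 'M[R]_(m, n)) (B : 'M[R]_(n, m)) :
  is_mxinverse A B -> is_mxinverse (A^T : 'M[R^c]_(n, m)) B^T.
Proof.
case=> AB BA; split; rewrite -trmx_mul_rev ?AB ?BA; apply/matrixP => a b;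
  by rewrite !mxE eq_sym.
Qed.

Lemma submx_set_tr (R : pzRingType) (m n : nat) (x : 'M[R]_(m, n)) I J :
  submx_set x^T J I = (submx_set x I J)^T.
Proof. by apply/matrixP => a b; rewrite !mxE. Qed.

Lemma mul3mx_converse (R : pzRingType) (m n p q : nat) (A : 'M[R]_(m, n))
    (B : 'M[R]_(n, p)) (C : 'M[R]_(p, q)) i j :
  (A *m B *m C) i j =
  ((C^T : 'M[R^c]_(q, p)) *m ((B^T : 'M[R^c]_(p, n)) *m A^T)) j i.
Proof.
have -> : (B^T : 'M[R^c]_(p, n)) *m A^T = (A *m B)^T by rewrite trmx_mul_rev.
have -> : (C^T : 'M[R^c]_(q, p)) *m (A *m B)^T = (A *m B *m C)^T.
  by rewrite (trmx_mul_rev (A *m B)).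
by rewrite [RHS]mxE.
Qed.

(** Transposition reverses matrix products when entries multiply in [R^c], so [r A^-1 c] becomes
    [c^T (A^T)^-1 r^T]: rows and columns trade roles. *)
Lemma quasidet_converse (R : pzRingType) (m n : nat) (x : 'M[R]_(m, n))
    I J i j :
  quasidet_defined x I J i j ->
  quasidet_defined (x^T : 'M[R^c]_(n, m)) J I j i /\
  quasidet (x^T : 'M[R^c]_(n, m)) J I j i = quasidet x I J i j.
Proof.
move=> hx; have [iI jJ xi xE] := quasidet_definedE hx.
have xi' := is_mxinverse_converse (mxinvertibleP xi).
rewrite -submx_set_tr in xi'.
have hx' : quasidet_defined (x^T : 'M[R^c]_(n, m)) J I j i.
  by case: hx => cIJ _ _ _; split=> //; right; eexists; apply: xi'.
split=> //; have [_ _ /mxinvertibleP xi'' ->] := quasidet_definedE hx'.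
rewrite xE mxE; congr (_ - _); rewrite (mxinverse_unique xi'' xi') -mulmxA.
rewrite [RHS]mul3mx_converse; congr (_ 0 0).
by congr mulmx; last congr mulmx; apply/matrixP => a b; rewrite !mxE.
Qed.

Lemma signr_converse (R : pzRingType) k : (-1 : R^c) ^+ k = (-1 : R) ^+ k.
Proof. by elim: k => // k IHk; rewrite exprS IHk [RHS]exprSr. Qed.

Lemma Delta_converse (R : pzRingType) (n : nat) k (u v : 'S_n) (x : 'M[R]_n) :
  Delta_defined k u v x ->
  Delta_defined k v u (x^T : 'M[R^c]_n) /\
  Delta k v u (x^T : 'M[R^c]_n) = Delta k u v x.
Proof.
move=> /quasidet_converse[hx xE]; split=> //.
(* A sign on the left in [R^c] is a sign on the right in [R], and signs are central. *)
rewrite /Delta /quasiminor xE addnC -[LHS]/(_ * _ :> R) signr_converse.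
exact (commr_sign (quasidet x _ _ _ _) _).
Qed.

Theorem proposition1p16 (R : pzRingType) (n : nat) (u v : 'S_n) (i : 'I_n)
    (hi : (i.+2 < n)%N) (x : 'M[R]_n) :
  let i1 := ordS i in
  let s := simple_transp i in
  let s1 := simple_transp i1 in
  (perm_length (u \oS s \oS s1 \oS s) = (perm_length u + 3)%N ->
   Delta_defined i1 (u \oS s1) v x ->
   Delta_defined i1 (u \oS s \oS s1) v x ->
   Delta_defined i (u \oS s1 \oS s) v x ->
   Delta_defined i (u \oS s) v x ->
   Delta_defined i1 u v x ->
   invertible (Delta i (u \oS s) v x) ->
   Delta i1 (u \oS s1) v x =
     Delta i1 (u \oS s \oS s1) v x +
     Delta i (u \oS s1 \oS s) v x * inverse (Delta i (u \oS s) v x) *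
       Delta i1 u v x)
  /\
  (perm_length (v \oS s \oS s1 \oS s) = (perm_length v + 3)%N ->
   Delta_defined i1 u (v \oS s1) x ->
   Delta_defined i1 u (v \oS s \oS s1) x ->
   Delta_defined i1 u v x ->
   Delta_defined i u (v \oS s) x ->
   Delta_defined i u (v \oS s1 \oS s) x ->
   invertible (Delta i u (v \oS s) x) ->
   Delta i1 u (v \oS s1) x =
     Delta i1 u (v \oS s \oS s1) x +
     Delta i1 u v x * inverse (Delta i u (v \oS s) x) *
       Delta i u (v \oS s1 \oS s) x).
Proof.
move=> i1 s s1; split=> [|hl hac hbc hba hbd hcd hinv].
  exact: Delta_row_exchange.
have [ac <-] := Delta_converse hac; have [bc <-] := Delta_converse hbc.
have [ba baE] := Delta_converse hba; have [bd bdE] := Delta_converse hbd.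
have [cd cdE] := Delta_converse hcd; have [iv ivE] := invertible_converse hinv.
rewrite -bdE in iv ivE.
(* The roles of [u] and [v] are swapped; the triple product in [R^c], read in [R], has its factors
   reversed, as the column identity requires. *)
by rewrite (Delta_row_exchange hi hl ac bc cd bd ba iv) ivE baE cdE bdE -mulrA.
Qed.
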